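(* Let $\mathcal{X}$ be a Polish space with Borel $\sigma$-field $\mathcal{B}$, and let $P$ be a Markov operator on $\mathcal{X}$ that admits a unique reversible invariant probability measure $\pi$. Suppose there exist a function $V:\mathcal{X}\to[1,\infty)$, numbers $b<\infty$ and $\alpha,\lambda>0$, a set $K\subseteq\mathcal{X}$, and a probability measure $\nu$ on $(\mathcal{X},\mathcal{B})$ such that $$PV\le (1-\lambda)V+b\,\mathbf{1}_K,$$ $$P\mathbf{1}_A(x)\ge \alpha\,\nu(A)\,\mathbf{1}_K(x)\quad\text{for all }A\in\mathcal{B},$$ and suppose that $K=\{x\in\mathcal{X}: V(x)\le R\}$ for some $R>\frac{2b}{\lambda}$. Then $P^2$ satisfies $$P^2V\le (1-\lambda')V+b'\,\mathbf{1}_K,$$ $$P^2\mathbf{1}_A(x)\ge \alpha'\,\nu(A)\,\mathbf{1}_K(x)\quad\text{for all }A\in\mathcal{B},$$ where $\lambda'=\lambda\left(\tfrac32-\lambda\right)$, $b'=(2-\lambda)b$ and $\alpha'=\alpha^2\nu(K)$. Consequently, $$\|P\|_{L^2_0(\pi)}\le (1-\beta^+)^{1/2},\qquad\text{with}\quad \beta^+=\frac{\lambda\left(\tfrac32-\lambda\right)}{1+\frac{2b(2-\lambda)}{\alpha^2\nu(K)}}.$$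
   Context: A Markov operator $P$ on $\mathcal{X}$ is given by a probability transition kernel $p:\mathcal{X}\times\mathcal{B}\to[0,1]$ via $Pf(x)=\int_{\mathcal{X}} f(y)\,p(x,dy)$ for bounded measurable $f$; $PV$ is understood through the same formula. It acts on probability measures by $\mu P(\cdot)=\int_{\mathcal{X}}p(x,\cdot)\,d\mu(x)$. A probability measure $\pi$ is invariant for $P$ if $\pi P=\pi$; then $P$ is a bounded linear operator on $L^2(\pi)$, the space of functions square integrable with respect to $\pi$, with inner product $\langle f,g\rangle_\pi=\int fg\,d\pi$ and norm $\|f\|_{2,\pi}^2=\langle f,f\rangle_\pi$. The invariant measure $\pi$ is reversible for $P$ if $\langle f,Pg\rangle_\pi=\langle Pf,g\rangle_\pi$ for all $f,g\in L^2(\pi)$. $L^2_0(\pi)=\{f\in L^2(\pi):\int f\,d\pi=0\}$, and $\|P\|_{L^2_0(\pi)}=\sup_{f\in L^2_0(\pi)}\|Pf\|_{2,\pi}/\|f\|_{2,\pi}$ (supremum over nonzero $f$). $\mathbf{1}_A$ is the indicator function of $A$, and $P^2$ is the composition of $P$ with itself. Inequalities between functions hold pointwise on $\mathcal{X}$.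
   Formalization: The formal theorem adds λ ≤ 1 (automatic unless K is the whole space); for λ > 1 the claim is false, e.g. one-point space, V=1, λ=10, b=100, α=1, R=21, where the bound on P²V would read 1 ≤ 86 − 800. *)

(* Defs.v *)
From HB Require Import structures.
From mathcomp Require Import all_boot all_order all_algebra.
From mathcomp Require Import all_classical all_reals all_analysis.

Set Implicit Arguments.
Unset Strict Implicit.
Unset Printing Implicit Defensive.

Import Order.TTheory GRing.Theory Num.Theory.
Import numFieldNormedType.Exports.

Local Open Scope classical_set_scope.
Local Open Scope ring_scope.

Definition is_polish (R : realType) (X : topologicalType) : Prop :=
  (exists2 D : set X, countable D & dense D) /\
  exists d : X -> X -> R,
    [/\ forall x y, d x y = 0 <-> x = y,
        forall x y, d x y = d y x,
        forall x y z, d x z <= d x y + d y z,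
        forall x (A : set X), nbhs x A <->
          exists2 e : R, 0 < e & [set y | d x y < e] `<=` A
      & forall u : nat -> X,
          (forall e : R, 0 < e -> exists N, forall m n : nat,
             (N <= m)%N -> (N <= n)%N -> d (u m) (u n) < e) ->
          exists l : X, u @ \oo --> l].

Notation borel X := (g_sigma_algebraType (@open X)).

Section markov_operator.
Context d (X : measurableType d) (R : realType).
Variable p : R.-pker X ~> X.

Definition markov_op (f : X -> \bar R) : X -> \bar R :=
  fun x => (\int[p x]_y f y)%E.

(* For f in L^2(pi) with pi invariant, f is p(x, .)-integrable for pi-almost
   every x; at the other points [fine] may return a spurious value, which does
   not affect any of the pi-integrals below. *)
Definition markov_opR (f : X -> R) : X -> R :=
  fun x => fine (markov_op (EFin \o f) x).

Variable pi : probability X R.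

Definition invariant_measure : Prop :=
  forall A, measurable A -> (\int[pi]_x p x A = pi A)%E.

Definition inner_pi (f g : X -> R) : R := \int[pi]_x (f x * g x).

Definition reversible_measure : Prop :=
  forall f g : X -> R, f \in Lfun pi 2%:E -> g \in Lfun pi 2%:E ->
    inner_pi f (markov_opR g) = inner_pi (markov_opR f) g.

Definition norm2 (f : X -> R) : \bar R := Lnorm pi 2%:E (EFin \o f).

Definition L20 : set (X -> R) :=
  [set f | f \in Lfun pi 2%:E /\ \int[pi]_x f x = 0].

(* The supremum is taken in [0, +oo]: the added 0 only matters when L^2_0(pi)
   has no nonzero element, where the norm is 0 and not sup set0 = -oo. *)
Definition opnorm_L20 : \bar R :=
  ereal_sup (0%E |`
    [set (norm2 (markov_opR f) / norm2 f)%E | f in [set f | L20 f /\ norm2 f != 0%E]]).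

End markov_operator.

Definition unique_reversible_invariant d (X : measurableType d) (R : realType)
    (p : R.-pker X ~> X) (pi : probability X R) : Prop :=
  [/\ invariant_measure p pi, reversible_measure p pi
    & forall mu : probability X R, invariant_measure p mu -> reversible_measure p mu ->
        forall A, measurable A -> mu A = pi A].

(* Division in \bar R has x / 0 = +oo for x > 0 and x / +oo = 0, so that
   beta_plus is 0 when nu(K) = 0 (the drift condition forces b > 0). *)
Definition beta_plus d (X : measurableType d) (R : realType)
    (lambda b alpha : R) (nu : probability X R) (K : set X) : \bar R :=
  ((lambda * (3 / 2 - lambda))%:E
    / (1 + (2 * b * (2 - lambda))%:E / ((alpha ^+ 2)%:E * nu K)))%E.

(* Main.v *)
(* Fix [f] of mean 0 and let [c] be its mean under [nu]. Cauchy-Schwarz under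
   [p x] gives [(P f - c)^2 <= P ((f - c)^2 / V) * P V]; integrating and moving [P]
   across by reversibility, the drift of [P^2] yields
     [|P f|^2 + c^2 <= (1 - lambda') (|f|^2 + c^2) + b' \int_K (f - c)^2 dpi].
   The term on [K] is a multiple of [|f|^2 - |P f|^2], the integral of the
   variance of [f] under [p x]: for [x] in [K] this variance is at least
   [(alpha / 2) P ((f - c)^2) x], and reversibility together with
   [P \1_K >= alpha nu(K) \1_K] gives
     [(alpha^2 nu(K) / 2) \int_K (f - c)^2 dpi <= |f|^2 - |P f|^2].
   The pointwise inequalities are stated in [\bar R] and hold at every point: where
   the integrals defining [P f] do not converge, the right-hand side is [+oo]. *)
Require Import Defs.
From HB Require Import structures.
From mathcomp Require Import all_boot all_order all_algebra.
From mathcomp Require Import all_classical all_reals all_analysis.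
From mathcomp Require Import measurable_realfun ring lra.

Set Implicit Arguments.
Unset Strict Implicit.
Unset Printing Implicit Defensive.

Import Order.TTheory GRing.Theory Num.Theory.
Import numFieldNormedType.Exports.

Local Open Scope classical_set_scope.
Local Open Scope ring_scope.
Local Open Scope ereal_scope.

(** * First and second moments under a probability measure *)

Section second_moment.
Context d (T : measurableType d) (R : realType).
Implicit Types (mu nu : probability T R) (f W : T -> R).

Lemma measurable_sqr_div f W : measurable_fun setT f ->
    measurable_fun setT W -> (forall x, 1 <= W x)%R ->
  measurable_fun setT (fun x => f x ^+ 2 / W x)%R.
Proof.
move=> mf mW W1.
(* Division becomes the power [-1], a measurable [powR]; the two agree since [W] is positive. *)
have -> : (fun x => f x ^+ 2 / W x)%R = (fun x => f x ^+ 2 * powR (W x) (-1))%R.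
  by apply/funext => x; rewrite powR_inv1// (le_trans ler01).
apply: measurable_funM; first exact: measurable_funX.
exact: (measurableT_comp (measurable_powR _)).
Qed.

(** For [w > 0], [a * w <= a ^+ 2 + w ^+ 2], so [|f|] is dominated by the integrable
    [f ^+ 2 / W + W]. *)
Lemma integrable_of_sqr_div mu f W : measurable_fun setT f ->
    measurable_fun setT W -> (forall x, 1 <= W x)%R ->
    \int[mu]_x (f x ^+ 2 / W x)%:E < +oo -> \int[mu]_x (W x)%:E < +oo ->
  mu.-integrable setT (EFin \o f).
Proof.
move=> mf mW W1 fW_fin W_fin.
have W0 x : (0 < W x)%R by rewrite (lt_le_trans ltr01).
have mfW := measurable_sqr_div mf mW W1.
apply: (@le_integrable _ _ _ _ _ _ _ (EFin \o (fun x => f x ^+ 2 / W x + W x)%R)) => //.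
- exact/measurable_EFinP.
- move=> x _ /=; rewrite lee_fin.
  have h : (`|f x| <= f x ^+ 2 / W x + W x)%R.
    rewrite -(ler_pM2r (W0 x)) mulrDl divfK ?gt_eqF// -real_normK ?num_real//.
    have := normr_ge0 (f x); have := W0 x.
    set a := `|_|%R; set w := W x; nra.
  by rewrite (le_trans h)// ler_norm.
- apply/integrableP; split; first by apply/measurable_EFinP; exact: measurable_funD.
  under eq_integral => x _.
    rewrite /= ger0_norm; last by rewrite addr_ge0 ?divr_ge0 ?sqr_ge0// ltW.
    rewrite EFinD; over.
  rewrite ge0_integralD //; first by apply: lte_add_pinfty.
  + by move=> x _; rewrite lee_fin divr_ge0 ?sqr_ge0// ltW.
  + exact/measurable_EFinP.
  + by move=> x _; rewrite lee_fin ltW.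
  + exact/measurable_EFinP.
Qed.

Lemma integrable_of_sqr mu f : measurable_fun setT f ->
  \int[mu]_x (f x ^+ 2)%:E < +oo -> mu.-integrable setT (EFin \o f).
Proof.
move=> mf f2; apply: (@integrable_of_sqr_div _ _ (cst 1%R)) => //.
  by under eq_integral do rewrite divr1.
rewrite (integral_cst mu measurableT 1) mul1e.
by rewrite [X in X < _](probability_setT mu) ltry.
Qed.

(** With [c] the mean of [f] this is the variance formula; for [f] of mean 0 the shift adds exactly
    [c ^+ 2]. *)
Lemma integral_sqr_sub_cst mu f c : measurable_fun setT f ->
    \int[mu]_x (f x ^+ 2)%:E < +oo ->
  \int[mu]_x ((f x - c) ^+ 2)%:E =
  \int[mu]_x (f x ^+ 2)%:E + (c ^+ 2 - 2 * c * fine (\int[mu]_x (f x)%:E))%:E.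
Proof.
move=> mf f2; have intf := integrable_of_sqr mf f2.
have intf2 : mu.-integrable setT (fun x => (f x ^+ 2)%:E).
  apply/integrableP; split; first by apply/measurable_EFinP; exact: measurable_funX.
  by under eq_integral do rewrite /= ger0_norm ?sqr_ge0//.
have icst : mu.-integrable setT (fun=> (c ^+ 2)%:E).
  exact: finite_measure_integrable_cst.
have ilin : mu.-integrable setT (fun x => ((- (2 * c)) * f x)%:E).
  by under eq_fun do rewrite EFinM; apply: integrableZl.
transitivity (\int[mu]_x ((f x ^+ 2)%:E + ((c ^+ 2)%:E + ((- (2 * c)) * f x)%:E))).
  by apply: eq_integral => x _; rewrite -!EFinD; congr (_%:E); ring.
rewrite integralD//=; last exact: integrableD.
rewrite integralD//=.
congr (_ + _).
rewrite (integral_cst mu measurableT (c ^+ 2)%:E) [X in _ * X + _](probability_setT mu) mule1.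
under eq_integral do rewrite EFinM.
rewrite integralZl//= -[X in _ * X]fineK ?integrable_fin_num//.
by rewrite -EFinM -EFinD; congr (_%:E); ring.
Qed.

(** The variance is nonnegative. A divergent second moment makes the right-hand side [+oo], so
    whatever value [fine] returns is harmless. *)
Lemma sqr_mean_le mu f : measurable_fun setT f ->
  ((fine (\int[mu]_x (f x)%:E)) ^+ 2)%:E <= \int[mu]_x (f x ^+ 2)%:E.
Proof.
move=> mf; have [->|f2] := eqVneq (\int[mu]_x (f x ^+ 2)%:E) +oo.
  exact: leey.
have f2y : \int[mu]_x (f x ^+ 2)%:E < +oo by rewrite ltey.
have := integral_sqr_sub_cst (fine (\int[mu]_x (f x)%:E)) mf f2y.
have : 0 <= \int[mu]_x ((f x - fine (\int[mu]_x (f x)%:E)) ^+ 2)%:E.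
  by apply: integral_ge0 => x _; rewrite lee_fin sqr_ge0.
have : 0 <= \int[mu]_x (f x ^+ 2)%:E.
  by apply: integral_ge0 => x _; rewrite lee_fin sqr_ge0.
case: (\int[mu]_x (f x ^+ 2)%:E) f2y => // s _ _.
set m := fine _ => + E; rewrite E -EFinD !lee_fin; lra.
Qed.

(** Cauchy-Schwarz for the factorization of [f - c] as [(f - c) / sqrt W] times [sqrt W], proved by
    completing a square. *)
Lemma sqr_mean_sub_le_weighted mu f W c : measurable_fun setT f ->
    measurable_fun setT W -> (forall x, 1 <= W x)%R ->
    \int[mu]_x (W x)%:E < +oo ->
  ((fine (\int[mu]_x (f x)%:E) - c) ^+ 2)%:E <=
  \int[mu]_x ((f x - c) ^+ 2 / W x)%:E * \int[mu]_x (W x)%:E.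
Proof.
move=> mf mW W1 W_fin.
have W0 x : (0 < W x)%R by rewrite (lt_le_trans ltr01).
have intW : mu.-integrable setT (EFin \o W).
  apply/integrableP; split; first exact/measurable_EFinP.
  by under eq_integral do rewrite /= ger0_norm ?ltW//.
have W_ge1 : 1 <= \int[mu]_x (W x)%:E.
  rewrite -(probability_setT mu) -(mul1e (mu setT)) -(integral_cst mu measurableT 1).
  apply: ge0_le_integral => //; first exact/measurable_EFinP.
  by move=> x _; rewrite lee_fin.
have mg : measurable_fun setT (fun x => f x - c)%R by exact: measurable_funB.
have mgW := measurable_sqr_div mg mW W1.
have gW0 x : (0 <= (f x - c) ^+ 2 / W x)%R by rewrite divr_ge0 ?sqr_ge0// ltW.
(* If the weighted square diverges, the product is [+oo] because the integral of [W] is at least 1;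
   otherwise [f - c] is integrable. *)
have [->|g2] := eqVneq (\int[mu]_x ((f x - c) ^+ 2 / W x)%:E) +oo.
  by rewrite gt0_mulye ?leey// (lt_le_trans lte01).
have {}g2 : \int[mu]_x ((f x - c) ^+ 2 / W x)%:E < +oo by rewrite ltey.
have intg := integrable_of_sqr_div mg mW W1 g2 W_fin.
have intgW : mu.-integrable setT (fun x => ((f x - c) ^+ 2 / W x)%:E).
  apply/integrableP; split; first exact/measurable_EFinP.
  by under eq_integral do rewrite /= ger0_norm//.
have icst : mu.-integrable setT (fun=> c%:E) by exact: finite_measure_integrable_cst.
have -> : fine (\int[mu]_x (f x)%:E) = (fine (\int[mu]_x (f x - c)%:E) + c)%R.
  transitivity (fine (\int[mu]_x ((f x - c)%:E + c%:E))).
    by congr fine; apply: eq_integral => x _; rewrite -EFinD subrK.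
  rewrite integralD//= (integral_cst mu measurableT c%:E).
  rewrite [X in fine (_ + _ * X)](probability_setT mu) mule1.
  by rewrite fineD ?integrable_fin_num.
rewrite addrK.
set m := fine _; set w := fine (\int[mu]_x (W x)%:E).
set a := fine (\int[mu]_x ((f x - c) ^+ 2 / W x)%:E).
have wE : \int[mu]_x (W x)%:E = w%:E by rewrite fineK ?integrable_fin_num.
have aE : \int[mu]_x ((f x - c) ^+ 2 / W x)%:E = a%:E.
  by rewrite fineK ?integrable_fin_num.
have mE : \int[mu]_x (f x - c)%:E = m%:E by rewrite fineK ?integrable_fin_num.
rewrite wE aE -EFinM lee_fin.
have w0 : (0 < w)%R by rewrite -lte_fin -wE (lt_le_trans _ W_ge1)// lte01.
(* The value [t = m / w] minimizes the integral of [(f - c - t * W) ^+ 2 / W]; the minimum is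
   [a - m ^+ 2 / w]. *)
have : 0 <= \int[mu]_x ((f x - c - m / w * W x) ^+ 2 / W x)%:E.
  by apply: integral_ge0 => x _; rewrite lee_fin divr_ge0 ?sqr_ge0// ltW.
have -> : \int[mu]_x ((f x - c - m / w * W x) ^+ 2 / W x)%:E =
    \int[mu]_x (((f x - c) ^+ 2 / W x)%:E +
      ((- (2 * (m / w)))%:E * (f x - c)%:E + ((m / w) ^+ 2)%:E * (W x)%:E)).
  apply: eq_integral => x _; rewrite -!EFinM -!EFinD; congr (_%:E).
  by field; rewrite !gt_eqF.
rewrite integralD//=; last by apply: integrableD => //; exact: integrableZl.
rewrite integralD//=; [|exact: integrableZl..].
rewrite !integralZl//= wE aE mE -!EFinM -!EFinD lee_fin.
have -> : (a + (- (2 * (m / w)) * m + (m / w) ^+ 2 * w) = (a * w - m ^+ 2) / w)%R.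
  by field; rewrite gt_eqF.
by rewrite pmulr_lge0 ?invr_gt0// subr_ge0.
Qed.

(* With [m] and [c] the means of [f] under [mu] and [nu], the variance of [f]
   under [mu] bounds [alpha * (m - c)^2], and [alpha <= 1]; hence the factor
   [alpha / 2]. *)
Lemma second_moment_minorized mu nu f (alpha : R) : measurable_fun setT f ->
    (0 < alpha)%R -> (forall A, measurable A -> alpha%:E * nu A <= mu A) ->
  ((fine (\int[mu]_x (f x)%:E)) ^+ 2)%:E + (alpha / 2)%:E *
    \int[mu]_x ((f x - fine (\int[nu]_y (f y)%:E)) ^+ 2)%:E <=
  \int[mu]_x (f x ^+ 2)%:E.
Proof.
move=> mf alpha0 numu.
have [->|f2] := eqVneq (\int[mu]_x (f x ^+ 2)%:E) +oo; first exact: leey.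
have {}f2 : \int[mu]_x (f x ^+ 2)%:E < +oo by rewrite ltey.
have alpha1 : (alpha <= 1)%R.
  have := numu _ measurableT; rewrite [X in _ * X](probability_setT nu).
  by rewrite [X in _ <= X](probability_setT mu) mule1 lee_fin.
(* The minorization passes from sets to nonnegative functions by comparing [mu] with the scaled
   measure [alpha * nu]. *)
have le_int (h : T -> R) : measurable_fun setT h -> (forall x, 0 <= h x)%R ->
    alpha%:E * \int[nu]_x (h x)%:E <= \int[mu]_x (h x)%:E.
  move=> mh h0; have ->: alpha = (NngNum (ltW alpha0))%:num by [].
  rewrite -ge0_integral_mscale//; last 2 first.
    exact/measurable_EFinP.
    by move=> x _; rewrite lee_fin.
  apply: ge0_le_measure_integral => //; exact/measurable_EFinP.
have f2_ge0 (q : probability T R) : 0 <= \int[q]_x (f x ^+ 2)%:E.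
  by apply: integral_ge0 => x _; rewrite lee_fin sqr_ge0.
have f2nu : \int[nu]_x (f x ^+ 2)%:E < +oo.
  have := le_int _ (measurable_funX 2 mf) (fun x => sqr_ge0 (f x)).
  move=> /le_lt_trans /(_ f2); case: (\int[nu]_x _) (f2_ge0 nu) => // [r _ _|_].
    exact: ltry.
  by rewrite gt0_muley ?lte_fin.
(* Applied to the square deviation from the [mu]-mean [m]: on the right stands the variance under
   [mu], and the [nu]-integral on the left is at least [(m - c) ^+ 2]. *)
have := le_int (fun x => (f x - fine (\int[mu]_y (f y)%:E)) ^+ 2)%R.
move=> /(_ (measurable_funX 2 (measurable_funB mf (measurable_cst _)))).
move=> /(_ (fun x => sqr_ge0 _)).
rewrite !integral_sqr_sub_cst//; have := sqr_mean_le nu mf.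
set m := fine (\int[mu]_x _); set c := fine (\int[nu]_x _).
case: (\int[mu]_x _) (f2_ge0 mu) f2 => // s _ _.
case: (\int[nu]_x _) (f2_ge0 nu) f2nu => // n _ _.
rewrite -!EFinD -!EFinM. rewrite !lee_fin => c2n key.
have var_le : (alpha * (m - c) ^+ 2 <= s - m ^+ 2)%R by nra.
have : (0 <= alpha * (m - c) ^+ 2)%R by rewrite mulr_ge0 ?sqr_ge0// ltW.
(* The second moment of [mu] around [c] is [(s - m ^+ 2) + (m - c) ^+ 2]; after multiplication by
   [alpha / 2] each summand is at most half the variance. *)
have : (0 <= (1 - alpha) * (s - m ^+ 2))%R.
  rewrite mulr_ge0 ?subr_ge0//; rewrite -subr_ge0; apply: le_trans var_le.
  by rewrite mulr_ge0 ?sqr_ge0// ltW.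
lra.
Qed.

End second_moment.

(** * Monotone convergence and truncation *)

Lemma cvg_ge0_nd_integral d (T : measurableType d) (R : realType)
    (mu : {measure set T -> \bar R}) (g : nat -> T -> \bar R) (f : T -> \bar R) :
    (forall n, measurable_fun setT (g n)) -> (forall n x, 0 <= g n x) ->
    (forall x, nondecreasing_seq (g ^~ x)) ->
    (forall x, g ^~ x @ \oo --> f x) ->
  \int[mu]_x g n x @[n --> \oo] --> \int[mu]_x f x.
Proof.
move=> mg g0 ndg gf.
have -> : f = fun x => limn (g ^~ x) by apply/funext => x; rewrite (cvg_lim _ (gf x)).
apply: cvg_monotone_convergence => //.
Qed.

Section truncation.
Context d (T : measurableType d) (R : realType).
Implicit Types (f : T -> R).

(** Cutting from above is enough to bound the nonnegative functions it is applied to, and keeps the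
    sequence nondecreasing in [n]. *)
Definition trunc_fun f (n : nat) : T -> R := fun x => Num.min (f x) n%:R.

Lemma measurable_trunc_fun f n : measurable_fun setT f ->
  measurable_fun setT (trunc_fun f n).
Proof. by move=> mf; exact: measurable_minr. Qed.

Lemma trunc_fun_ge0 f n : (forall x, 0 <= f x)%R ->
  forall x, (0 <= trunc_fun f n x)%R.
Proof. by move=> f0 x; rewrite /trunc_fun le_min f0 ler0n. Qed.

Lemma trunc_fun_le f n x : (trunc_fun f n x <= n%:R)%R.
Proof. by rewrite /trunc_fun ge_min lexx orbT. Qed.

Lemma nd_trunc_fun f x : nondecreasing_seq (trunc_fun f ^~ x).
Proof.
move=> m n mn; rewrite /trunc_fun le_min !ge_min lexx/=.
by rewrite ler_nat mn orbT.
Qed.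

Lemma near_trunc_fun f x : \forall n \near \oo, trunc_fun f n x = f x.
Proof.
near=> n; rewrite /trunc_fun; apply/min_idPl.
near: n; exact: nbhs_infty_ger.
Unshelve. all: by end_near. Qed.

End truncation.

(** * Square integrability and the norm of [L^2] *)

Section square_integrable.
Context d (T : measurableType d) (R : realType).
Variable mu : probability T R.
Implicit Types (f : T -> R).

Lemma Lfun2_sqrP f : measurable_fun setT f ->
  \int[mu]_x (f x ^+ 2)%:E < +oo -> f \in Lfun mu 2%:E.
Proof.
move=> mf f2; rewrite inE/=; apply/andP; split; rewrite inE//=.
rewrite /finite_norm unlock poweR_lty//.
under eq_integral => x _.
  by rewrite /= powR_mulrn// real_normK ?num_real//; over.
by [].
Qed.

Lemma bounded_sqr_lty f (M : R) : measurable_fun setT f ->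
  (forall x, `|f x| <= M)%R -> \int[mu]_x (f x ^+ 2)%:E < +oo.
Proof.
move=> mf fM; apply: (@le_lt_trans _ _ (\int[mu]_x (cst (M ^+ 2)%:E x))).
  apply: ge0_le_integral => //.
  - by move=> x _; rewrite lee_fin sqr_ge0.
  - by apply/measurable_EFinP; exact: measurable_funX.
  - move=> x _; rewrite /= lee_fin -[leLHS]real_normK ?num_real//.
    by rewrite lerXn2r ?nnegrE// (le_trans _ (fM x)).
rewrite (integral_cst mu measurableT (M ^+ 2)%:E).
by rewrite [X in _ * X](probability_setT mu) mule1 ltry.
Qed.

Lemma norm2E f : norm2 mu f = (\int[mu]_x (f x ^+ 2)%:E) `^ 2^-1.
Proof.
rewrite /norm2 unlock; congr (_ `^ _); apply: eq_integral => x _ /=.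
by rewrite powR_mulrn// real_normK ?num_real.
Qed.

End square_integrable.

(** * The Markov operator and reversibility for nonnegative functions *)

Section markov.
Context d (X : measurableType d) (R : realType).
Variables (p : R.-pker X ~> X) (pi : probability X R).
Implicit Types (f g h : X -> R).

(** A name for [p x] that carries the structure of a probability measure, so that the moment
    inequalities apply to it. *)
Definition kernel_at (x : X) : set X -> \bar R := p x.

HB.instance Definition _ x := Measure.on (kernel_at x).

HB.instance Definition _ x :=
  Measure_isProbability.Build _ _ _ (kernel_at x) (prob_kernel x).

Lemma markov_op_ge0 (h : X -> \bar R) : (forall x, 0 <= h x) ->
  forall x, 0 <= markov_op p h x.
Proof. by move=> h0 x; apply: integral_ge0 => y _; exact: h0. Qed.

Lemma measurable_markov_op (h : X -> \bar R) : measurable_fun setT h ->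
  (forall x, 0 <= h x) -> measurable_fun setT (markov_op p h).
Proof.
move=> mh h0; apply: measurable_fun_integral_kernel => // U mU.
exact: measurable_kernel.
Qed.

Lemma measurable_markov_opR f : measurable_fun setT f ->
  measurable_fun setT (markov_opR p f).
Proof.
move=> mf; apply: (measurableT_comp (fine_measurable measurableT)).
rewrite (_ : markov_op p _ = (fun x => markov_op p (EFin \o f)^\+ x -
    markov_op p (EFin \o f)^\- x)); last first.
  by apply/funext => x; rewrite /markov_op integralE.
by apply: emeasurable_funB; apply: measurable_markov_op => //;
  [apply: measurable_funepos|apply: measurable_funeneg]; exact/measurable_EFinP.
Qed.

Lemma le_markov_op (g h : X -> \bar R) : measurable_fun setT g ->
    measurable_fun setT h -> (forall x, 0 <= g x) -> (forall x, g x <= h x) ->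
  forall x, markov_op p g x <= markov_op p h x.
Proof. by move=> mg mh g0 gh x; apply: ge0_le_integral. Qed.

Lemma markov_op_cst (c : \bar R) x : markov_op p (cst c) x = c.
Proof.
by rewrite /markov_op (integral_cst (p x) measurableT c) prob_kernel mule1.
Qed.

Hypothesis rev : reversible_measure p pi.

(** Between 0 and [M] everything is in [L^2] and [fine] loses nothing, so the real-valued
    reversibility transfers to [\bar R]. *)
Lemma reversible_bounded g h (M : R) :
    measurable_fun setT g -> (forall x, 0 <= g x)%R -> (forall x, g x <= M)%R ->
    measurable_fun setT h -> (forall x, 0 <= h x)%R -> (forall x, h x <= M)%R ->
  \int[pi]_x ((g x)%:E * markov_op p (EFin \o h) x) =
  \int[pi]_x (markov_op p (EFin \o g) x * (h x)%:E).
Proof.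
have P_fin (k : X -> R) : measurable_fun setT k -> (forall x, 0 <= k x)%R ->
    (forall x, k x <= M)%R -> forall x,
    (0 <= markov_opR p k x <= M)%R /\ markov_op p (EFin \o k) x = (markov_opR p k x)%:E.
  move=> mk k0 kM x.
  have Pk0 : 0 <= markov_op p (EFin \o k) x.
    by apply: markov_op_ge0 => y; rewrite lee_fin.
  have PkM : markov_op p (EFin \o k) x <= M%:E.
    rewrite -[leRHS](markov_op_cst _ x); apply: le_markov_op => //.
    exact/measurable_EFinP.
  have Pkf : markov_op p (EFin \o k) x = (markov_opR p k x)%:E.
    by rewrite fineK// ge0_fin_numE// (le_lt_trans PkM)// ltry.
  by rewrite -!lee_fin -Pkf Pk0.
move=> mg g0 gM mh h0 hM.
have L2 (k : X -> R) : measurable_fun setT k -> (forall x, 0 <= k x)%R ->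
    (forall x, k x <= M)%R -> k \in Lfun pi 2%:E.
  move=> mk k0 kM; apply: Lfun2_sqrP => //; apply: (@bounded_sqr_lty _ _ _ _ _ M) => //.
  by move=> x; rewrite ger0_norm.
have := rev (L2 _ mg g0 gM) (L2 _ mh h0 hM).
rewrite /inner_pi /Rintegral => rev_gh.
under eq_integral do rewrite (P_fin _ mh h0 hM _).2 -EFinM.
under [RHS]eq_integral do rewrite (P_fin _ mg g0 gM _).2 -EFinM.
have fin (k l : X -> R) : measurable_fun setT k -> measurable_fun setT l ->
    (forall x, 0 <= k x <= M)%R -> (forall x, 0 <= l x <= M)%R ->
    \int[pi]_x (k x * l x)%:E \is a fin_num.
  move=> mk ml kM lM; apply: integrable_fin_num => //.
  apply/Lfun1_integrable; apply: Lfun2_mul_Lfun1; apply: L2 => // x;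
  by [case/andP: (kM x)|case/andP: (lM x)].
(* Reversibility equates the [fine] parts only; the equality in [\bar R] also needs both integrals
   finite. *)
rewrite -[LHS]fineK ?rev_gh ?fineK//; apply: fin => //; try exact: measurable_markov_opR.
- by move=> x; case: (P_fin _ mg g0 gM x).
- by move=> x; rewrite h0 hM.
- by move=> x; rewrite g0 gM.
- by move=> x; case: (P_fin _ mh h0 hM x).
Qed.

Lemma cvg_markov_op_trunc h : measurable_fun setT h -> (forall x, 0 <= h x)%R ->
  forall x, markov_op p (EFin \o trunc_fun h n) x @[n --> \oo] -->
    markov_op p (EFin \o h) x.
Proof.
move=> mh h0 x; apply: cvg_ge0_nd_integral.
- by move=> n; apply/measurable_EFinP; exact: measurable_trunc_fun.
- by move=> n y; rewrite lee_fin trunc_fun_ge0.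
- by move=> y m n mn; rewrite lee_fin; exact: nd_trunc_fun.
- move=> y; apply: cvg_near_cst.
  by apply: filterS (near_trunc_fun h y) => n /= ->.
Qed.

Lemma nd_markov_op_trunc h x : measurable_fun setT h -> (forall x, 0 <= h x)%R ->
  nondecreasing_seq (fun n => markov_op p (EFin \o trunc_fun h n) x).
Proof.
move=> mh h0 m n mn; apply: le_markov_op => [||y|y].
- by apply/measurable_EFinP; exact: measurable_trunc_fun.
- by apply/measurable_EFinP; exact: measurable_trunc_fun.
- by rewrite lee_fin trunc_fun_ge0.
- by rewrite lee_fin; exact: nd_trunc_fun.
Qed.

(** Both functions are truncated at the same level [n], where the bounded case applies; monotone
    convergence on each side and uniqueness of limits conclude. Infinite values are allowed. *)
Lemma reversible_ge0 g h :
    measurable_fun setT g -> (forall x, 0 <= g x)%R ->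
    measurable_fun setT h -> (forall x, 0 <= h x)%R ->
  \int[pi]_x ((g x)%:E * markov_op p (EFin \o h) x) =
  \int[pi]_x (markov_op p (EFin \o g) x * (h x)%:E).
Proof.
have cvg_pair (k l : X -> R) : measurable_fun setT k -> (forall x, 0 <= k x)%R ->
    measurable_fun setT l -> (forall x, 0 <= l x)%R ->
    \int[pi]_x ((trunc_fun k n x)%:E * markov_op p (EFin \o trunc_fun l n) x)
      @[n --> \oo] --> \int[pi]_x ((k x)%:E * markov_op p (EFin \o l) x).
  move=> mk k0 ml l0; apply: cvg_ge0_nd_integral => [n|n x|x m n mn|x].
  - apply: emeasurable_funM; last apply: measurable_markov_op.
    + by apply/measurable_EFinP; exact: measurable_trunc_fun.
    + by apply/measurable_EFinP; exact: measurable_trunc_fun.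
    + by move=> x; rewrite lee_fin trunc_fun_ge0.
  - rewrite mule_ge0 ?lee_fin ?trunc_fun_ge0// markov_op_ge0// => y.
    by rewrite lee_fin trunc_fun_ge0.
  - apply: lee_pmul.
    + by rewrite lee_fin trunc_fun_ge0.
    + by apply: markov_op_ge0 => y; rewrite lee_fin trunc_fun_ge0.
    + by rewrite lee_fin; exact: nd_trunc_fun.
    + exact: nd_markov_op_trunc.
  (* At a fixed [x] the first factor is eventually the finite constant [k x], so only the second one
     varies and no product of 0 and [+oo] has to be passed to the limit. *)
  - have kx : (k x)%:E \is a fin_num by [].
    have := cvgeZl kx (@cvg_markov_op_trunc _ ml l0 x); apply: cvg_trans.
    apply: near_eq_cvg; apply: filterS (near_trunc_fun k x) => n ->.
    by [].
move=> mg g0 mh h0.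
under [RHS]eq_integral do rewrite muleC.
apply: (cvg_unique _ (cvg_pair _ _ mg g0 mh h0)) => //.
have := cvg_pair _ _ mh h0 mg g0; apply: cvg_trans.
apply: near_eq_cvg; near=> n.
rewrite (reversible_bounded (M := n%:R)) //; try exact: measurable_trunc_fun;
  try exact: trunc_fun_ge0; try exact: trunc_fun_le.
by apply: eq_integral => x _; rewrite muleC.
Unshelve. all: by end_near. Qed.

End markov.

(** * Drift and minorization for the square of the operator *)

Section drift_minorization.
Context d (X : measurableType d) (R : realType).
Variable p : R.-pker X ~> X.
Implicit Types (f V : X -> R) (K : set X).

(* Evaluate the drift condition near the infimum [m] of [V]: if [b <= 0] it would
   give [m <= (1 - lambda) V x] there. *)
Lemma drift_constant_gt0 V K (b lambda : R) (x0 : X) : measurable_fun setT V ->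
    (forall x, 1 <= V x)%R -> (0 < lambda)%R -> (lambda <= 1)%R ->
    (forall x, markov_op p (EFin \o V) x <=
       ((1 - lambda) * V x + b * \1_K x)%:E) ->
  (0 < b)%R.
Proof.
move=> mV V1 l0 l1 drift; rewrite ltNge; apply/negP => b0.
pose m := inf (range V).
have lbV : has_lbound (range V) by exists 1%R => _ [x _ <-].
have infV : has_inf (range V) by split; first by exists (V x0), x0.
have m1 : (1 <= m)%R by apply: lb_le_inf; [exists (V x0), x0|move=> _ [x _ <-]].
have mVx x : (m <= V x)%R by apply: ge_inf => //; exists x.
have m_le x : (m <= (1 - lambda) * V x)%R.
  rewrite -lee_fin; apply: (@le_trans _ _ (markov_op p (EFin \o V) x)).
    rewrite -[leLHS](markov_op_cst p _ x); apply: le_markov_op => //.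
    - exact/measurable_EFinP.
    - by move=> y; rewrite lee_fin (le_trans ler01).
  apply: (le_trans (drift x)); rewrite lee_fin gerDl.
  by rewrite mulr_le0_ge0.
(* The margin [lambda * m] gives [V x < (1 + lambda) * m], whence [m <= (1 - lambda ^+ 2) * m],
   absurd for [m >= 1]. *)
have [_ [x _ <-] Vx] := inf_adherent (mulr_gt0 l0 (lt_le_trans ltr01 m1)) infV.
have := m_le x; rewrite -/m in Vx.
have : (0 < lambda * (lambda * m))%R by rewrite !mulr_gt0// (lt_le_trans ltr01).
have : (0 <= (1 - lambda) * (m + lambda * m - V x))%R.
  by rewrite mulr_ge0// subr_ge0// ltW.
lra.
Qed.

Lemma markov_op_indic_le1 K x : measurable K -> markov_op p (EFin \o \1_K) x <= 1.
Proof.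
move=> mK; rewrite -[leRHS](markov_op_cst p _ x); apply: le_markov_op => //.
- by apply/measurable_EFinP; exact: measurable_indic.
- by move=> y; rewrite lee_fin.
- by move=> y; rewrite /= indicE; case: (y \in K); rewrite lee_fin ?ler01.
Qed.

(** Using the drift twice with [P \1_K <= 1] gives [(1 - lambda) ^+ 2 * V + (1 - lambda) * b * \1_K
    + b]. The new coefficient of [V] is [(1 - lambda) ^+ 2 + lambda / 2]; the last [b] is absorbed
    on [K] by the indicator term and off [K] by [lambda / 2 * V]. *)
Lemma drift_sqr V K (b lambda r : R) : measurable_fun setT V ->
    (forall x, 1 <= V x)%R -> (0 <= b)%R -> (0 < lambda)%R -> (lambda <= 1)%R ->
    (forall x, markov_op p (EFin \o V) x <=
       ((1 - lambda) * V x + b * \1_K x)%:E) ->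
    measurable K -> (2 * b / lambda < r)%R -> K = [set x | (V x <= r)%R] ->
  forall x, markov_op p (markov_op p (EFin \o V)) x <=
    ((1 - lambda * (3 / 2 - lambda)) * V x + (2 - lambda) * b * \1_K x)%:E.
Proof.
move=> mV V1 b0 l0 l1 drift mK br KE x.
have V0 y : (0 <= V y)%R by rewrite (le_trans ler01).
have mPV : measurable_fun setT (markov_op p (EFin \o V)).
  by apply: measurable_markov_op => //; exact/measurable_EFinP.
have l1' : (0 <= 1 - lambda)%R by rewrite subr_ge0.
have mI : measurable_fun setT (EFin \o \1_K : X -> \bar R).
  by apply/measurable_EFinP; exact: measurable_indic.
have mVE : measurable_fun setT (EFin \o V) by exact/measurable_EFinP.
apply: (@le_trans _ _ (markov_op p (EFin \o (fun y => (1 - lambda) * V y + b * \1_K y)%R) x)).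
  apply: le_markov_op => //.
    apply/measurable_EFinP; apply: measurable_funD; apply: measurable_funM => //.
  by apply: markov_op_ge0 => y; rewrite lee_fin.
have -> : markov_op p (EFin \o (fun y => (1 - lambda) * V y + b * \1_K y)%R) x =
    (1 - lambda)%:E * markov_op p (EFin \o V) x + b%:E * markov_op p (EFin \o \1_K) x.
  rewrite /markov_op; under eq_integral do rewrite /= EFinD !EFinM.
  rewrite ge0_integralD//.
  - congr (_ + _); rewrite (ge0_integralZl_EFin _ measurableT)//.
    by move=> y _; rewrite lee_fin.
  - by move=> y _; rewrite mule_ge0 ?lee_fin.
  - exact: measurable_funeM.
  - by move=> y _; rewrite mule_ge0 ?lee_fin.
  - exact: measurable_funeM.
apply: (@le_trans _ _ ((1 - lambda) * ((1 - lambda) * V x + b * \1_K x) + b)%:E).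
  rewrite [leRHS]EFinD; apply: leeD; first by rewrite EFinM; exact: lee_wpmul2l.
  rewrite -[leRHS]mule1; apply: lee_wpmul2l => //; exact: markov_op_indic_le1.
rewrite lee_fin indicE KE; have [xK|/negP xK] := boolP (x \in _).
  rewrite -subr_ge0 (_ : _ - _ = lambda / 2 * V x)%R; last by rewrite /=; field.
  by rewrite mulr_ge0// divr_ge0// ltW.
(* Off [K], [V x] exceeds [r > 2 * b / lambda], which is exactly [b < lambda / 2 * V x]. *)
have rV : (r < V x)%R by rewrite ltNge; apply/negP => Vr; apply: xK; rewrite inE.
have : (b <= lambda / 2 * V x)%R.
  have := lt_trans br rV; rewrite ltr_pdivrMr// => /ltW; lra.
rewrite /=; lra.
Qed.

(** Apply [P] to the minorization of [P \1_A], then use the minorization of [P \1_K]; this second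
    use produces the factor [nu K]. *)
Lemma minorization_sqr K (alpha : R) (nu : probability X R) : (0 <= alpha)%R ->
    measurable K ->
    (forall A, measurable A -> forall x,
       alpha%:E * nu A * (\1_K x)%:E <= markov_op p (EFin \o \1_A) x) ->
  forall A, measurable A -> forall x,
    (alpha ^+ 2)%:E * nu K * nu A * (\1_K x)%:E <=
    markov_op p (markov_op p (EFin \o \1_A)) x.
Proof.
move=> a0 mK minor A mA x.
have nuE B : measurable B -> nu B = (fine (nu B))%:E by move=> mB; rewrite fineK ?fin_num_measure.
have nu0 B : (0 <= fine (nu B))%R by rewrite fine_ge0.
have aA0 : (0 <= alpha * fine (nu A))%R by rewrite mulr_ge0.
have mI B : measurable B -> measurable_fun setT (EFin \o \1_B : X -> \bar R).
  by move=> mB; apply/measurable_EFinP; exact: measurable_indic.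
apply: (@le_trans _ _ (markov_op p (fun y => (alpha * fine (nu A))%:E * (\1_K y)%:E) x)); last first.
  apply: le_markov_op.
  - by apply: measurable_funeM; apply/measurable_EFinP; exact: measurable_indic.
  - by apply: measurable_markov_op => [|y]; [exact: mI|rewrite lee_fin].
  - by move=> y; rewrite mule_ge0 ?lee_fin.
  - by move=> y; rewrite EFinM -nuE// minor.
rewrite /markov_op ge0_integralZl_EFin//; last exact: mI.
apply: (@le_trans _ _ ((alpha * fine (nu A))%:E * (alpha%:E * nu K * (\1_K x)%:E))).
  rewrite (nuE K)// (nuE A)// -!EFinM lee_fin le_eqVlt; apply/orP; left; apply/eqP; ring.
by apply: lee_wpmul2l => //; exact: minor.
Qed.

End drift_minorization.

(** * Integrated consequences of drift and minorization *)

Section contraction.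
Context d (X : measurableType d) (R : realType).
Variables (p : R.-pker X ~> X) (pi : probability X R).
Hypothesis rev : reversible_measure p pi.
Implicit Types (f V : X -> R) (K : set X).

(** Reversibility against the constant 1, which [P] fixes. *)
Lemma reversible_invariant_ge0 f : measurable_fun setT f ->
    (forall x, 0 <= f x)%R ->
  \int[pi]_x markov_op p (EFin \o f) x = \int[pi]_x (f x)%:E.
Proof.
move=> mf f0; transitivity (\int[pi]_x ((cst 1%R x)%:E * markov_op p (EFin \o f) x)).
  by apply: eq_integral => x _; rewrite mul1e.
rewrite reversible_ge0//; apply: eq_integral => x _.
by rewrite (_ : EFin \o cst 1%R = cst 1)// markov_op_cst mul1e.
Qed.

(* Cauchy-Schwarz against the weight [V] under [p x], integrated and
   transposed by reversibility. *)
Lemma lyapunov_contraction V K (a b c : R) f : measurable_fun setT V ->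
    (forall x, 1 <= V x)%R -> (forall x, markov_op p (EFin \o V) x < +oo) ->
    measurable K -> (0 <= a)%R -> (0 <= b)%R ->
    (forall x, markov_op p (markov_op p (EFin \o V)) x <=
       (a * V x + b * \1_K x)%:E) ->
    measurable_fun setT f ->
  \int[pi]_x ((markov_opR p f x - c) ^+ 2)%:E <=
  a%:E * \int[pi]_x ((f x - c) ^+ 2)%:E +
  b%:E * \int[pi]_x ((f x - c) ^+ 2 * \1_K x)%:E.
Proof.
move=> mV V1 PV_fin mK a0 b0 drift mf.
have V0 y : (0 < V y)%R by rewrite (lt_le_trans ltr01).
have PV_ge0 : forall x, 0 <= markov_op p (EFin \o V) x.
  by apply: markov_op_ge0 => y; rewrite lee_fin ltW.
have PVE : markov_op p (EFin \o V) = EFin \o markov_opR p V.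
  by apply/funext => x; rewrite /= fineK// ge0_fin_numE.
have v0 x : (0 <= markov_opR p V x)%R by rewrite fine_ge0.
have mv := measurable_markov_opR p mV.
have mg : measurable_fun setT (fun x => f x - c)%R by exact: measurable_funB.
have mgV := measurable_sqr_div mg mV V1.
have gV0 x : (0 <= (f x - c) ^+ 2 / V x)%R by rewrite divr_ge0 ?sqr_ge0// ltW.
have mgVE : measurable_fun setT (EFin \o (fun x => (f x - c) ^+ 2 / V x)%R).
  exact/measurable_EFinP.
have mg2 : measurable_fun setT (fun x => (f x - c) ^+ 2)%R by exact: measurable_funX.
have mI : measurable_fun setT (\1_K : X -> R) by exact: measurable_indic.
pose G := EFin \o (fun x => (f x - c) ^+ 2 / V x)%R.
(* Pointwise Cauchy-Schwarz bounds the integrand by [P G * P V]; moving the first [P] across then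
   leaves [G * P (P V)], to which the drift applies. *)
apply: (@le_trans _ _ (\int[pi]_x (markov_op p G x * (markov_opR p V x)%:E))).
  apply: ge0_le_integral => //.
  - by move=> x _; rewrite lee_fin sqr_ge0.
  - apply/measurable_EFinP; apply: measurable_funX; apply: measurable_funB => //.
    exact: measurable_markov_opR.
  - apply: emeasurable_funM; last exact/measurable_EFinP.
    by apply: measurable_markov_op => // y; rewrite lee_fin.
  - move=> x _.
    have := @sqr_mean_sub_le_weighted _ _ _ (kernel_at p x) _ _ c mf mV V1 (PV_fin x).
    by rewrite -[X in _ * X]/(markov_op p (EFin \o V) x) PVE.
rewrite -reversible_ge0//.
have split_ge0 : \int[pi]_x (a * (f x - c) ^+ 2 + b * ((f x - c) ^+ 2 * \1_K x))%:E =
    a%:E * \int[pi]_x ((f x - c) ^+ 2)%:E +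
    b%:E * \int[pi]_x ((f x - c) ^+ 2 * \1_K x)%:E.
  under eq_integral do rewrite EFinD.
  have mg2I : measurable_fun setT (fun x => (f x - c) ^+ 2 * \1_K x)%R.
    exact: measurable_funM.
  rewrite ge0_integralD//.
  - congr (_ + _); under eq_integral do rewrite EFinM.
      rewrite (ge0_integralZl_EFin _ measurableT)//; last exact/measurable_EFinP.
      by move=> x _; rewrite lee_fin sqr_ge0.
    rewrite (ge0_integralZl_EFin _ measurableT)//; last exact/measurable_EFinP.
    by move=> x _; rewrite lee_fin mulr_ge0// sqr_ge0.
  - by move=> x _; rewrite lee_fin mulr_ge0// sqr_ge0.
  - by apply/measurable_EFinP; exact: measurable_funM.
  - by move=> x _; rewrite lee_fin mulr_ge0// mulr_ge0// sqr_ge0.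
  - by apply/measurable_EFinP; exact: measurable_funM.
rewrite -split_ge0; apply: ge0_le_integral => //.
- move=> x _; rewrite mule_ge0//; first exact: gV0.
  by apply: markov_op_ge0 => y; rewrite lee_fin.
- apply: emeasurable_funM => //; apply: measurable_markov_op => [|y].
    exact/measurable_EFinP.
  by rewrite lee_fin.
- apply/measurable_EFinP; apply: measurable_funD; apply: measurable_funM => //.
  exact: measurable_funM.
- move=> x _; rewrite -PVE.
  apply: (@le_trans _ _ (((f x - c) ^+ 2 / V x)%:E * (a * V x + b * \1_K x)%:E)).
    by apply: lee_wpmul2l; rewrite ?lee_fin.
  rewrite -EFinM lee_fin -subr_ge0.
  (* The weight cancels against [a * V]; in the term on [K] it is dropped using [V >= 1]. *)
  rewrite (_ : _ - _ = b * \1_K x * (((f x - c) ^+ 2 / V x) * (V x - 1)))%R.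
    by rewrite mulr_ge0 ?(mulr_ge0 _ (gV0 x))// mulr_ge0// ?subr_ge0// mulr_ge0.
  by field; rewrite gt_eqF.
Qed.

(* On [K] the variance of [p x] dominates [alpha / 2] times the second moment
   around the mean of [f] under [nu]; reversibility then moves [\1_K] to
   [P \1_K >= alpha * nu K * \1_K]. *)
Lemma minorization_contraction K (alpha c : R) (nu : probability X R) f :
    (0 < alpha)%R -> measurable K ->
    (forall A, measurable A -> forall x,
       alpha%:E * nu A * (\1_K x)%:E <= markov_op p (EFin \o \1_A) x) ->
    measurable_fun setT f -> c = fine (\int[nu]_x (f x)%:E) ->
  \int[pi]_x ((markov_opR p f x) ^+ 2)%:E +
    (alpha ^+ 2 * fine (nu K) / 2)%:E * \int[pi]_x ((f x - c) ^+ 2 * \1_K x)%:E <=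
  \int[pi]_x (f x ^+ 2)%:E.
Proof.
move=> alpha0 mK minor mf cE.
have mg2 : measurable_fun setT (fun x => (f x - c) ^+ 2)%R.
  by apply: measurable_funX; exact: measurable_funB.
have mf2 : measurable_fun setT (fun x => f x ^+ 2)%R by exact: measurable_funX.
have mI : measurable_fun setT (\1_K : X -> R) by exact: measurable_indic.
have g2_ge0 x : (0 <= (f x - c) ^+ 2)%R by exact: sqr_ge0.
have nuKE : nu K = (fine (nu K))%:E by rewrite fineK ?fin_num_measure.
have k0 : (0 <= fine (nu K))%R by exact: fine_ge0.
have mPg2 : measurable_fun setT (markov_op p (EFin \o (fun x => (f x - c) ^+ 2)%R)).
  by apply: measurable_markov_op => [|y]; [exact/measurable_EFinP|rewrite lee_fin].
(* With the integral of [f ^+ 2] written as that of [P (f ^+ 2)], the claim reduces to a pointwise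
   inequality under each [p x]. *)
rewrite -(reversible_invariant_ge0 mf2)//; last by move=> x; exact: sqr_ge0.
apply: (@le_trans _ _ (\int[pi]_x ((markov_opR p f x) ^+ 2)%:E + (alpha / 2)%:E *
    \int[pi]_x ((\1_K x)%:E * markov_op p (EFin \o (fun x => (f x - c) ^+ 2)%R) x))).
  apply: leeD2l.
  rewrite reversible_ge0//.
  (* The factor [alpha / 2] comes from the variance bound, [alpha * fine (nu K)] from the lower
     bound on [P \1_K]. *)
  have -> : (alpha ^+ 2 * fine (nu K) / 2 = alpha / 2 * (alpha * fine (nu K)))%R.
    by field.
  rewrite [X in X * _ <= _]EFinM -muleA; apply: lee_wpmul2l.
    by rewrite lee_fin divr_ge0// ltW.
  rewrite -(ge0_integralZl_EFin _ measurableT)//; last 3 first.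
  - by move=> x _; rewrite lee_fin mulr_ge0.
  - by apply/measurable_EFinP; exact: measurable_funM.
  - by rewrite mulr_ge0// ltW.
  apply: ge0_le_integral => //.
  - move=> x _; rewrite mule_ge0// lee_fin; first by rewrite mulr_ge0// ltW.
    by rewrite mulr_ge0.
  - apply: measurable_funeM; apply/measurable_EFinP; exact: measurable_funM.
  - apply: emeasurable_funM; last exact/measurable_EFinP.
    by apply: measurable_markov_op => [|y]; [exact/measurable_EFinP|rewrite lee_fin].
  - move=> x _; rewrite [X in _ * X]EFinM [X in _ * X]muleC muleA.
    apply: lee_wpmul2r; first by rewrite lee_fin.
    by rewrite EFinM -nuKE; exact: minor.
have mPf : measurable_fun setT (markov_opR p f) by exact: measurable_markov_opR.
rewrite -(ge0_integralZl_EFin _ measurableT)//; last 3 first.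
- move=> x _; rewrite mule_ge0 ?lee_fin//.
  by apply: markov_op_ge0 => y; rewrite lee_fin.
- by apply: emeasurable_funM => //; exact/measurable_EFinP.
- by rewrite divr_ge0// ltW.
have mIPg2 : measurable_fun setT (fun x => (\1_K x)%:E *
    markov_op p (EFin \o (fun x => (f x - c) ^+ 2)%R) x).
  by apply: emeasurable_funM => //; exact/measurable_EFinP.
have IPg2_ge0 x : 0 <= (\1_K x)%:E * markov_op p (EFin \o (fun x => (f x - c) ^+ 2)%R) x.
  by rewrite mule_ge0 ?lee_fin//; apply: markov_op_ge0 => y; rewrite lee_fin.
have mPf2 : measurable_fun setT (fun x => (markov_opR p f x ^+ 2)%:E).
  by apply/measurable_EFinP; exact: measurable_funX.
rewrite -ge0_integralD//; last 3 first.
- by move=> x _; rewrite lee_fin sqr_ge0.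
- by move=> x _; rewrite mule_ge0// lee_fin divr_ge0// ltW.
- exact: measurable_funeM.
apply: ge0_le_integral => //.
- move=> x _; rewrite adde_ge0 ?lee_fin ?sqr_ge0// mule_ge0// lee_fin.
  by rewrite divr_ge0// ltW.
- by apply: emeasurable_funD => //; exact: measurable_funeM.
- apply: measurable_markov_op => [|y]; first exact/measurable_EFinP.
  by rewrite lee_fin sqr_ge0.
- move=> x _; rewrite indicE; have [xK|xK] := boolP (x \in K); last first.
    rewrite mul0e mule0 adde0.
    exact: (@sqr_mean_le _ _ _ (kernel_at p x)).
  rewrite mul1e cE; apply: (@second_moment_minorized _ _ _ (kernel_at p x)) => // A mA.
  have := minor A mA x; rewrite indicE xK mule1 => /le_trans; apply.
  rewrite /markov_op /comp integral_indic//.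
  by rewrite setIT.
Qed.

End contraction.

(** * Contraction on mean-zero functions and the operator norm *)

Section spectral_gap.
Context d (X : measurableType d) (R : realType).
Variables (p : R.-pker X ~> X) (pi : probability X R).
Hypothesis rev : reversible_measure p pi.

(** Pair [f] with the constant 1. This keeps [P f] centred, so the shift by [c] creates no cross
    term. *)
Lemma reversible_mean f : f \in Lfun pi 2%:E ->
  (\int[pi]_x markov_opR p f x = \int[pi]_x f x)%R.
Proof.
move=> f2; have := rev f2 (Lfun_cst pi 1%R 2%R).
have -> : markov_opR p (cst 1%R) = cst 1%R.
  apply/funext => x; rewrite /markov_opR.
  by rewrite (_ : EFin \o cst 1%R = cst 1)// markov_op_cst.
rewrite /inner_pi; under eq_Rintegral do rewrite mulr1.
by move=> ->; apply: eq_Rintegral => x _; rewrite mulr1.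
Qed.

(* [D] stands for [\int_K (f - c)^2 dpi]. *)
Lemma gap_arith (S T D c l b k : R) : (0 <= l)%R -> (0 <= b)%R -> (0 < k)%R ->
    (T + c ^+ 2 <= (1 - l) * (S + c ^+ 2) + b * D)%R ->
    (T + k / 2 * D <= S)%R ->
  (T <= (1 - l / (1 + 2 * b / k)) * S)%R.
Proof.
move=> l0 b0 k0 drift minor.
have q0 : (0 < 1 + 2 * b / k)%R.
  by rewrite ltr_pwDl// divr_ge0// ?mulr_ge0// ltW.
have lc : (0 <= l * c ^+ 2)%R by rewrite mulr_ge0// sqr_ge0.
have bD : (b * D <= 2 * b / k * (S - T))%R.
  have -> : (b * D = 2 * b / k * (k / 2 * D))%R by field; rewrite gt_eqF.
  by rewrite ler_wpM2l ?lerBrDl// divr_ge0 ?mulr_ge0// ltW.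
(* The drift bound gives [l * S <= S - T + b * D - l * c ^+ 2]; the last term is dropped and [bD]
   bounds [b * D]. *)
have : (l * S / (1 + 2 * b / k) <= S - T)%R by rewrite ler_pdivrMr//; lra.
lra.
Qed.

(** The rate is asserted only for [nu K > 0]: at 0 the real quotient [2 * b / 0] is 0 and would give
    the rate [1 - l]. The plain contraction [T <= S] serves the degenerate case. *)
Lemma L20_contraction (V : X -> R) (K : set X) (alpha b l : R) (nu : probability X R) :
    measurable_fun setT V -> (forall x, 1 <= V x)%R ->
    (forall x, markov_op p (EFin \o V) x < +oo) -> measurable K ->
    (0 < alpha)%R -> (0 <= b)%R -> (0 <= l <= 1)%R ->
    (forall x, markov_op p (markov_op p (EFin \o V)) x <=
       ((1 - l) * V x + b * \1_K x)%:E) ->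
    (forall A, measurable A -> forall x,
       alpha%:E * nu A * (\1_K x)%:E <= markov_op p (EFin \o \1_A) x) ->
  forall f, L20 pi f -> exists S T : R,
    [/\ \int[pi]_x (f x ^+ 2)%:E = S%:E,
        \int[pi]_x (markov_opR p f x ^+ 2)%:E = T%:E,
        (T <= S)%R
      & (0 < fine (nu K))%R ->
        (T <= (1 - l / (1 + 2 * b / (alpha ^+ 2 * fine (nu K)))) * S)%R].
Proof.
move=> mV V1 PV_fin mK alpha0 b0 /andP[l0 l1] drift minor f [f2 f0].
have mf : measurable_fun setT f by move/sub_Lfun_mfun: f2; rewrite inE.
have mPf := measurable_markov_opR p mf.
have Pf0 : fine (\int[pi]_x (markov_opR p f x)%:E) = 0%R.
  by rewrite -[LHS]/(Rintegral pi setT (markov_opR p f)) reversible_mean.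
have := minorization_contraction rev alpha0 mK minor mf erefl.
have := lyapunov_contraction rev (fine (\int[nu]_x (f x)%:E)) mV V1 PV_fin mK.
move=> /(_ _ _ _ _ _ drift mf) => /(_ _ b0).
rewrite subr_ge0 => /(_ l1); set c := fine (\int[nu]_x (f x)%:E) => E1 E2.
have sq_ge0 (g : X -> R) : 0 <= \int[pi]_x (g x ^+ 2)%:E.
  by apply: integral_ge0 => x _; rewrite lee_fin sqr_ge0.
have fS : \int[pi]_x (f x ^+ 2)%:E < +oo.
  exact/integrable_lty/(Lfun2_integrable_sqr f2).
have D0 : 0 <= \int[pi]_x ((f x - c) ^+ 2 * \1_K x)%:E.
  by apply: integral_ge0 => x _; rewrite lee_fin mulr_ge0 ?sqr_ge0.
have k0 : (0 <= fine (nu K))%R by exact: fine_ge0.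
have TS : \int[pi]_x (markov_opR p f x ^+ 2)%:E <= \int[pi]_x (f x ^+ 2)%:E.
  apply: le_trans E2; rewrite leeDl// mule_ge0// lee_fin.
  by rewrite divr_ge0// mulr_ge0// sqr_ge0.
have fT := le_lt_trans TS fS.
(* This makes the integral over [K] finite, so that the inequalities can be read in [R]. *)
have DS : \int[pi]_x ((f x - c) ^+ 2 * \1_K x)%:E <= \int[pi]_x ((f x - c) ^+ 2)%:E.
  apply: ge0_le_integral => //.
  - by move=> x _; rewrite lee_fin mulr_ge0 ?sqr_ge0.
  - apply/measurable_EFinP; apply: measurable_funM; last exact: measurable_indic.
    by apply: measurable_funX; exact: measurable_funB.
  - by apply/measurable_EFinP; apply: measurable_funX; exact: measurable_funB.
  - move=> x _; rewrite lee_fin ler_piMr ?sqr_ge0// indicE.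
have f0' : fine (\int[pi]_x (f x)%:E) = 0%R := f0.
have Sc : \int[pi]_x ((f x - c) ^+ 2)%:E = \int[pi]_x (f x ^+ 2)%:E + (c ^+ 2)%:E.
  by rewrite integral_sqr_sub_cst// f0' mulr0 subr0.
have Tc : \int[pi]_x ((markov_opR p f x - c) ^+ 2)%:E =
    \int[pi]_x (markov_opR p f x ^+ 2)%:E + (c ^+ 2)%:E.
  by rewrite integral_sqr_sub_cst// Pf0 mulr0 subr0.
move: E1 E2 TS DS D0 fS fT; rewrite Sc Tc.
have := sq_ge0 f; have := sq_ge0 (markov_opR p f).
case: (\int[pi]_x (f x ^+ 2)%:E) => // S.
case: (\int[pi]_x (markov_opR p f x ^+ 2)%:E) => // T.
case: (\int[pi]_x ((f x - c) ^+ 2 * \1_K x)%:E) => // D.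
move=> T0 S0 E1 E2 TS DS D0 _ _.
exists S, T; split => // kpos.
apply: (gap_arith (D := D) (c := c)) => //.
exact: mulr_gt0 (exprn_gt0 _ alpha0) kpos.
Qed.

(** Each quotient of norms is the square root of [T / S]; the added element 0 of the supremum is
    below any power. *)
Lemma opnorm_L20_le (rho : R) :
    (forall f, L20 pi f -> exists S T : R,
      [/\ \int[pi]_x (f x ^+ 2)%:E = S%:E,
          \int[pi]_x (markov_opR p f x ^+ 2)%:E = T%:E
        & (T <= rho * S)%R]) ->
  opnorm_L20 p pi <= rho%:E `^ (1 / 2).
Proof.
move=> H; apply: ge_ereal_sup => _ [->|[f [fL2 f_neq0] <-]]; first exact: poweR_ge0.
have [S [T [SE TE TS]]] := H f fL2.
have S0 : (0 <= S)%R.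
  by rewrite -lee_fin -SE; apply: integral_ge0 => x _; rewrite lee_fin sqr_ge0.
have T0 : (0 <= T)%R.
  by rewrite -lee_fin -TE; apply: integral_ge0 => x _; rewrite lee_fin sqr_ge0.
move: f_neq0; rewrite !norm2E SE TE !poweR_EFin eqe => S_neq0.
have {S_neq0}Sgt0 : (0 < S)%R.
  rewrite lt_neqAle S0 andbT; apply: contra_neq S_neq0 => <-.
  by rewrite powR0// invr_eq0 pnatr_eq0.
(* The sign of [rho] is forced by [0 <= T <= rho * S] with [S > 0]. *)
have rho0 : (0 <= rho)%R by rewrite -(pmulr_lge0 _ Sgt0) (le_trans T0).
rewrite inver gt_eqF ?powR_gt0// -EFinM lee_fin ler_pdivrMr ?powR_gt0//.
rewrite div1r -powRM//; apply: ge0_ler_powR; rewrite ?nnegrE ?invr_ge0// mulr_ge0//.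
Qed.

End spectral_gap.

(** * The value of the rate and the final bound *)

Lemma beta_plus_nu0 d (X : measurableType d) (R : realType)
    (lambda b alpha : R) (nu : probability X R) (K : set X) :
  (0 < b)%R -> (lambda <= 1)%R -> nu K = 0 -> beta_plus lambda b alpha nu K = 0.
Proof.
move=> b0 l1 nuK; rewrite /beta_plus nuK mule0 inve0 gt0_muley; last first.
  by rewrite lte_fin !mulr_gt0// subr_gt0 (le_lt_trans l1)// ltr1n.
by rewrite addey// invey mule0.
Qed.

(** All divisors are nonzero, so the quotients of [\bar R] are real ones, regrouped around
    [b' = (2 - lambda) * b] to match the contraction rate. *)
Lemma beta_plus_gt0 d (X : measurableType d) (R : realType)
    (lambda b alpha k : R) (nu : probability X R) (K : set X) :
    (0 <= b)%R -> (0 < alpha)%R -> (lambda <= 1)%R -> nu K = k%:E -> (0 < k)%R ->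
  beta_plus lambda b alpha nu K =
  (lambda * (3 / 2 - lambda) / (1 + 2 * ((2 - lambda) * b) / (alpha ^+ 2 * k)))%:E.
Proof.
move=> b0 a0 l1 nuK k0; have ak0 : (0 < alpha ^+ 2 * k)%R.
  by apply: mulr_gt0 => //; exact: exprn_gt0.
have l2 : (0 <= 2 - lambda)%R by lra.
rewrite /beta_plus nuK -EFinM inver gt_eqF// -EFinM -EFinD inver gt_eqF.
  by rewrite -EFinM; congr (_ / (1 + _ / _))%:E; ring.
by rewrite ltr_pwDl// divr_ge0 ?(ltW ak0)// mulr_ge0// mulr_ge0.
Qed.

Theorem proposition1 (R : realType) (X : ptopologicalType)
    (hX : is_polish R X)
    (p : R.-pker (borel X) ~> (borel X)) (pi : probability (borel X) R)
    (hpi : unique_reversible_invariant p pi)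
    (V : borel X -> R) (mV : measurable_fun setT V)
    (V1 : forall x, (1 <= V x)%R)
    (b alpha lambda : R) (alpha0 : (0 < alpha)%R) (lambda0 : (0 < lambda)%R)
    (lambda1 : (lambda <= 1)%R)
    (K : set (borel X)) (nu : probability (borel X) R)
    (drift : forall x, markov_op p (EFin \o V) x <=
       ((1 - lambda) * V x + b * \1_K x)%:E)
    (minor : forall A : set (borel X), measurable A -> forall x,
       alpha%:E * nu A * (\1_K x)%:E <= markov_op p (EFin \o \1_A) x)
    (r : R) (hr : (2 * b / lambda < r)%R)
    (hK : K = [set x | (V x <= r)%R]) :
  let lambda' := (lambda * (3 / 2 - lambda))%R in
  let b' := ((2 - lambda) * b)%R in
  let alpha' := (alpha ^+ 2)%:E * nu K in
  [/\ forall x, markov_op p (markov_op p (EFin \o V)) x <=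
        ((1 - lambda') * V x + b' * \1_K x)%:E,
      forall A : set (borel X), measurable A -> forall x,
        alpha' * nu A * (\1_K x)%:E <= markov_op p (markov_op p (EFin \o \1_A)) x
    & opnorm_L20 p pi <= (1 - beta_plus lambda b alpha nu K) `^ (1 / 2)].
Proof.
have mK : measurable K.
  rewrite hK -[X in measurable X]setTI.
  have -> : [set x | (V x <= r)%R] = V @^-1` `]-oo, r].
    by apply/seteqP; split => x /=; rewrite in_itv.
  exact: mV.
have b0 : (0 < b)%R := drift_constant_gt0 (point : borel X) mV V1 lambda0 lambda1 drift.
move=> lambda' b' alpha'.
have drift2 := drift_sqr mV V1 (ltW b0) lambda0 lambda1 drift mK hr hK.
split.
- exact: drift2.
- exact: minorization_sqr (ltW alpha0) mK minor.
have [_ rev _] := hpi.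
have PV_fin x : markov_op p (EFin \o V) x < +oo by rewrite (le_lt_trans (drift x)) ?ltry.
have b'0 : (0 <= b')%R by rewrite /b' mulr_ge0 ?subr_ge0 ?(le_trans lambda1) ?ler1n// ltW.
(* On [[0, 1]] the quadratic [lambda * (3 / 2 - lambda)] is nonnegative, with maximum [9 / 16]. *)
have l'0 : (0 <= lambda' <= 1)%R by rewrite /lambda'; apply/andP; split; nra.
have contr := L20_contraction rev mV V1 PV_fin mK alpha0 b'0 l'0 drift2 minor.
have nuKE : nu K = (fine (nu K))%:E by rewrite fineK ?fin_num_measure.
have : (0 <= fine (nu K))%R by exact: fine_ge0.
(* If [nu K = 0] then [beta_plus] is 0 and the bound says only that [P] is a contraction. *)
rewrite le_eqVlt => /predU1P[/esym k0|k0].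
  have nuK0 : nu K = 0 by rewrite nuKE k0.
  rewrite beta_plus_nu0// sube0; apply: (opnorm_L20_le (rho := 1%R)) => f.
  by move=> /contr[S [T [SE TE TS _]]]; exists S, T; rewrite mul1r.
rewrite (beta_plus_gt0 (ltW b0) alpha0 lambda1 nuKE k0) -EFinB.
apply: opnorm_L20_le => f /contr[S [T [SE TE _ TS]]]; exists S, T; split => //.
exact: TS.
Qed.
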